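(* Let $X$ be an infinite Lindelöf real GO-space. Then the following assertions are equivalent: (1) $X$ is Menger. (2) $X$ is totally paracompact. (3) $X$ is totally metacompact.
   Context: A real GO-space (real generalized-ordered space) is a triple $(X,<,\tau)$ where $X\subseteq\mathbb{R}$, $<$ is the usual order of $\mathbb{R}$ restricted to $X$, and $\tau$ is a Hausdorff topology on $X$ generated by some family of intervals of $X$ (possibly degenerate, i.e. singletons are allowed); here intervals of $X$ are order-convex subsets of $X$. One writes $X$ for $(X,<,\tau)$, and topological notions refer to $\tau$. A space is Lindelöf if every open cover has a countable subcover. A space $X$ is totally paracompact (totally metacompact) if every open base of $X$ contains, as a subfamily, a locally finite (respectively point-finite) cover of $X$. A space $X$ is Menger if for every sequence $\mathcal{U}_0,\mathcal{U}_1,\dots$ of open covers of $X$ there are finite sets $\mathcal{F}_0\subseteq\mathcal{U}_0,\mathcal{F}_1\subseteq\mathcal{U}_1,\dots$ such that $\bigcup_{n\in\omega}\mathcal{F}_n$ is a cover of $X$. *)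

(* Defs.v *)
From HB Require Import structures.
From mathcomp Require Import all_boot all_order all_algebra.
From mathcomp Require Import all_classical all_reals topology.

Set Implicit Arguments.
Unset Strict Implicit.
Unset Printing Implicit Defensive.

Import Order.TTheory GRing.Theory Num.Theory.

Local Open Scope classical_set_scope.
Local Open Scope ring_scope.

Section real_GO_space.
Context {R : realType}.

Definition order_convex (X : set R) (I : set X) :=
  forall x y z : X, I x -> I y -> val x <= val z <= val y -> I z.

(* A copy of the type of points of X whose topology is the coarsest one
   containing the members of G, instead of the topology inherited from R
   that is canonical on set_type X. *)
Definition GO_type (X : set R) (G : set (set X)) : Type := set_type X.

HB.instance Definition _ (X : set R) (G : set (set X)) :=
  Choice.on (GO_type G).
HB.instance Definition _ (X : set R) (G : set (set X)) :=
  isSubBaseTopological.Build (GO_type G) G id.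

Definition real_GO_space (X : set R) (G : set (set X)) :=
  (forall I, G I -> order_convex I) /\ hausdorff_space (GO_type G).

End real_GO_space.

Section covering_properties.
Context (T : topologicalType).
Implicit Types U V B : set (set T).

Definition covers U := \bigcup_(A in U) A = [set: T].

Definition open_cover U := U `<=` open /\ covers U.

Definition locally_finite U := forall x : T,
  exists2 O, nbhs x O & finite_set [set A | U A /\ A `&` O !=set0].

Definition point_finite U := forall x : T, finite_set [set A | U A /\ A x].

Definition lindelof := forall U, open_cover U ->
  exists V, [/\ V `<=` U, countable V & covers V].

Definition totally_paracompact := forall B, basis B ->
  exists V, [/\ V `<=` B, locally_finite V & covers V].

Definition totally_metacompact := forall B, basis B ->
  exists V, [/\ V `<=` B, point_finite V & covers V].

Definition menger := forall U : nat -> set (set T),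
  (forall n, open_cover (U n)) ->
  exists F : nat -> set (set T),
    (forall n, F n `<=` U n /\ finite_set (F n)) /\ covers (\bigcup_n F n).

End covering_properties.

(* Main.v *)
Require Import Defs.
From mathcomp Require Import all_boot all_order all_algebra.
From mathcomp Require Import all_classical all_reals topology.

(* Menger implies totally paracompact in every regular space.  In the Menger
   game played along a base, ONE offers shrunk members [C] (with closure in a
   member [A] of the base) such that [A] either lies in the union of the members
   already picked or misses the shrunk sets already picked.  Hurewicz's argument
   gives a play won by TWO; dropping the [A]'s of the first kind from it leaves
   a locally finite cover.

   Conversely, let [d n] be a sequence meeting every neighbourhood of every
   non-isolated point (for a subset of the line, pick points between rationals).
   Given open covers [U n], the open sets that contain some [d n] and are
   covered by finitely many members of [U n] form a base together with the open
   singletons, because [O `&` (C `|` D)] is such a set when [C] and [D] in [U n]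
   contain the given point and [d n].  A point-finite subcover selects finitely
   many members of each [U n], which cover all but a closed discrete, hence
   countable, set. *)

Set Implicit Arguments.
Unset Strict Implicit.
Unset Printing Implicit Defensive.

Import Order.TTheory GRing.Theory Num.Theory.

Local Open Scope classical_set_scope.

(** * The Menger game and a play won by TWO *)

Lemma menger_lindelof (T : topologicalType) : menger T -> lindelof T.
Proof.
move=> mT U ocU; have [F [FU covF]] := mT (fun=> U) (fun=> ocU).
exists (\bigcup_n F n); split=> //.
  by move=> A [n _]; apply: (FU n).1.
by apply: bigcup_countable => // n _; apply/finite_set_countable/(FU n).2.
Qed.

(** Turns a finite selection from an increasing cover into a single index, which can serve as an
    answer in the game. *)
Lemma subset_bigcup_nondecreasing (T : Type) (V : nat -> set T)
    (F : set (set T)) :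
  (forall k k', (k <= k')%N -> V k `<=` V k') ->
  finite_set F -> F `<=` range V -> exists k, \bigcup_(A in F) A `<=` V k.
Proof.
move=> ndV /finite_seqP[s ->] {F}; elim: s => [|A s IHs] sV.
  by exists 0%N => x [A].
have [|k sk] := IHs; first by move=> B /= Bs; apply: sV; rewrite /= inE Bs orbT.
have [|j _ jA] := sV A; first by rewrite /= inE eqxx.
exists (maxn k j) => x [B /=]; rewrite inE => /orP[/eqP -> Ax|Bs Bx].
  by apply: (ndV j); [exact: leq_maxr|rewrite jA].
by apply: (ndV k); [exact: leq_maxl|apply: sk; exists B].
Qed.

Section menger_game.
Context {T : topologicalType}.
Variable K : seq nat -> set T.
Hypothesis openK : forall s, open (K s).
Hypothesis subK : forall s k, K s `<=` K (rcons s k).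
Hypothesis leK : forall s k k', (k <= k')%N -> K (rcons s k) `<=` K (rcons s k').
Hypothesis covK : forall s x, exists k, K (rcons s k) x.

(** These points are covered after [s], then at most [n] arbitrary answers bounded by [k], then the
    answer [k]. Requiring [K (rcons s k)] at every depth takes care of answers above [k], and so
    yields monotonicity in [k]. *)
Fixpoint caught n k (s : seq nat) : set T :=
  K (rcons s k) `&`
  (if n is m.+1 then \bigcap_(j in `I_k.+1) caught m k (rcons s j) else setT).

Lemma open_caught n k s : open (caught n k s).
Proof.
elim: n s => [|n IHn] s; apply: openI => //; first exact: openT.
rewrite -closedC setC_bigcap; apply: closed_bigcup => // j _.
exact: open_closedC.
Qed.

Lemma subset_caught n k s : K s `<=` caught n k s.
Proof.
elim: n s => [|n IHn] s x Ksx; split=> //; try exact: subK.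
by move=> j _; apply: IHn; exact: subK.
Qed.

Lemma leq_caught n k k' s : (k <= k')%N -> caught n k s `<=` caught n k' s.
Proof.
move=> kk'; elim: n s => [|n IHn] s x [Kx cx]; split; try exact: leK Kx.
  by [].
move=> j /= jk'; have [jk|kj] := leqP j k; first exact/IHn/cx.
by apply: subset_caught; apply: leK Kx; exact: ltnW.
Qed.

Lemma caught_cover n s x : exists k, caught n k s x.
Proof.
elim: n s => [|n IHn] s; first by have [k Kx] := covK s x; exists k.
have [k0 Kx] := covK s x.
have [f fP] := choice (fun j => IHn (rcons s j)).
(* Answers from [k0] on cover [x] at once, so only the finitely many thresholds [f j] with [j < k0]
   matter. *)
exists (maxn k0 (\max_(j < k0) f j)); split.
  by apply: leK Kx; exact: leq_maxl.
move=> j _; have [jk0|k0j] := ltnP j k0; last exact/subset_caught/(leK k0j Kx).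
apply: leq_caught (fP j); apply: leq_trans (leq_maxr _ _).
exact: (leq_bigmax (F := fun j : 'I_k0 => f j) (Ordinal jk0)).
Qed.

Lemma caught_play n k h x : (forall i, (i < n)%N -> (h i <= k)%N) ->
  caught n k [::] x -> K (rcons (mkseq h n) k) x.
Proof.
move=> hk cx; suff /(_ n (leqnn n)) : forall i, (i <= n)%N ->
    caught (n - i) k (mkseq h i) x by rewrite subnn => -[].
elim=> [|i IHi] lin; first by rewrite subn0.
have := IHi (ltnW lin); rewrite -(subnSK lin) => -[_].
by rewrite mkseqS; apply; apply: hk.
Qed.

(* [K s] is the set TWO has covered after the history [s] in the Menger game.
   As [K] is monotone, a point met within the first [k] answers of ONE's cover
   stays met, so only finitely many histories matter for it: this makes
   [caught n ^~ [::]] an open cover. *)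
Lemma menger_game : menger T ->
  exists h : nat -> nat, forall x, exists n, K (mkseq h n) x.
Proof.
move=> mT; have [|F [FP covF]] := mT (fun n => range (fun k => caught n k [::])).
  move=> n; split; first by move=> _ [k _ <-]; exact: open_caught.
  rewrite /covers -subTset => x _; have [k cx] := caught_cover n [::] x.
  by exists (caught n k [::]) => //; exists k.
have /choice[g gP] n : exists k, \bigcup_(A in F n) A `<=` caught n k [::].
  have [Fn finF] := FP n.
  by apply: subset_bigcup_nondecreasing => // *; exact: leq_caught.
(* The running maximum dominates [g n] and bounds all earlier answers by [h n], as [caught_play]
   requires. *)
pose h n := \max_(i < n.+1) g i.
have leh i n : (i <= n)%N -> (h i <= h n)%N.
  move=> lin; apply/bigmax_leqP => j _.
  have jn : (j < n.+1)%N by rewrite (leq_trans (ltn_ord j)).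
  exact: (leq_bigmax (F := fun j : 'I_n.+1 => g j) (Ordinal jn)).
exists h => x; have : [set: T] x by [].
rewrite -covF => -[A [n _ FA] Ax]; exists n.+1; rewrite mkseqS.
apply: caught_play => [i /ltnW/leh //|]; apply: (@leq_caught n (g n)).
  exact: (leq_bigmax (F := fun j : 'I_n.+1 => g j) ord_max).
by apply: gP; exists A.
Qed.

End menger_game.

(** * From a won play to a locally finite cover *)

Section menger_totally_paracompact.
Context {T : topologicalType}.
Variable B : set (set T).
Hypothesis basisB : basis B.

(* Position of the game: the union of the shrunk sets picked so far, and the
   union of the members of the base they come from. *)
Let position := (set T * set T)%type.

Definition legal (p : position) := open p.1 /\ open p.2 /\ closure p.1 `<=` p.2.

Definition valid_move (p q : position) :=
  legal q /\ (q.2 `<=` p.2 \/ B q.2 /\ q.2 `&` p.1 = set0).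

(** A point of [p.2] has a member of the base inside [p.2]; any other point is outside
    [closure p.1], hence has one missing [p.1]. Regularity shrinks these members and the Lindelöf
    property enumerates the shrunk sets. *)
Lemma exists_moves (p : position) : regular_space T -> lindelof T -> legal p ->
  exists e : nat -> position,
    (forall k, valid_move p (e k)) /\ forall x, exists k, (e k).1 x.
Proof.
move=> regT linT [_ [op2 clp]].
(* The empty move is the default for indices [k] with [g k] outside [V]. *)
have moveN : valid_move p (set0, set0).
  by split; [rewrite /legal closure0; do !split=> //; exact: open0|left].
pose U := [set C | exists A, valid_move p (C, A)].
have [|V [VU cV covV]] := linT U.
  split; first by move=> C [A [[]]].
  rewrite /covers -subTset => x _.
  have [A [BA Ax]] : exists A, [/\ B A, A x &
      A `<=` p.2 \/ A `&` p.1 = set0].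
    have [px|px] := pselect (p.2 x).
      have /basisB.2[A [BA Ax] Ap] : nbhs x p.2 by apply: open_nbhs_nbhs.
      by exists A; split=> //; left.
    have /basisB.2[A [BA Ax] Ap] : nbhs x (~` closure p.1).
      apply: open_nbhs_nbhs; split; first exact/closed_openC/closed_closure.
      by move/clp.
    exists A; split=> //; right; apply/disjoints_subset.
    by apply: subset_trans Ap _; apply: subsetC; exact: subset_closure.
  move=> Ap; have oA := basisB.1 _ BA.
  have /regT[C nC CA] : nbhs x A by apply: open_nbhs_nbhs.
  exists C^°%classic; last exact: nC.
  exists A; split; last by case: Ap; [left|right].
  split=> /=; first exact: open_interior.
  by split=> //; apply: subset_trans CA; apply: closureS; exact: interior_subset.
have [g gV] : exists g : nat -> set T, set_surj setT V g by exact/pcard_surjP.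
have /choice[e eP] k : exists q, valid_move p q /\ (V (g k) -> q.1 = g k).
  have [/VU[A mA]|nV] := pselect (V (g k)); first by exists (g k, A).
  by exists (set0, set0).
exists e; split=> [k|x]; first exact: (eP k).1.
have : [set: T] x by [].
rewrite -covV => -[C VC Cx]; have [k _ gk] := gV C VC.
by exists k; rewrite (eP k).2 gk.
Qed.

Section play.
Variable e : position -> nat -> position.
Hypothesis e_move : forall p, legal p -> forall k, valid_move p (e p k).

(** Answer [k] takes all moves up to [k], so that larger answers cover more, as the game lemma
    demands. Only finitely many moves are taken, so closures commute with the union and legality
    persists. *)
Definition next (p : position) k : position :=
  (p.1 `|` \bigcup_(i in `I_k.+1) (e p i).1,
   p.2 `|` \bigcup_(i in `I_k.+1) (e p i).2).

Definition reached (s : seq nat) := foldl next (set0, set0) s.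

Lemma reached_rcons s k : reached (rcons s k) = next (reached s) k.
Proof. by rewrite /reached foldl_rcons. Qed.

Lemma legal_reached s : legal (reached s).
Proof.
elim/last_ind: s => [|s k IHs].
  by rewrite /legal /= closure0; do !split => //; exact: open0.
have le i : legal (e (reached s) i) := (e_move IHs i).1.
rewrite reached_rcons; have [o1 [o2 cl]] := IHs; split.
  by apply: openU => //; apply: bigcup_open => i _; exact: (le i).1.
split; first by apply: openU => //; apply: bigcup_open => i _; exact: (le i).2.1.
have : closed (closure (reached s).1 `|`
    \bigcup_(i in `I_k.+1) closure (e (reached s) i).1).
  apply: closedU; first exact: closed_closure.
  by apply: closed_bigcup => // i _; exact: closed_closure.
move=> /closure_id clE x /= clx; have : closure (closure (reached s).1 `|`
    \bigcup_(i in `I_k.+1) closure (e (reached s) i).1) x.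
  apply: closureS clx; apply: setUSS; first exact: subset_closure.
  by apply: subset_bigcup => i _; exact: subset_closure.
rewrite -clE => -[/cl ?|[i ik] /(le i).2.2 ?]; first by left.
by right; exists i.
Qed.

(** The members kept at stage [n] miss [(p n).1]. Once [(p N).1] contains [x], this neighbourhood
    meets only members kept before stage [N], and these are finitely many. *)
Lemma play_totally_paracompact (h : nat -> nat) :
  (forall x, exists n, (reached (mkseq h n)).1 x) ->
  exists V, [/\ V `<=` B, locally_finite V & covers V].
Proof.
move=> hP; pose p n := reached (mkseq h n).
have pS n : p n.+1 = next (p n) (h n) by rewrite /p mkseqS reached_rcons.
have lp n : legal (p n) by exact: legal_reached.
have le1 m n : (m <= n)%N -> (p m).1 `<=` (p n).1.
  move=> /subnKC <-; elim: (n - m)%N => [|k IHk]; first by rewrite addn0.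
  by rewrite addnS pS => x /IHk; left.
pose V := [set A | exists n i, [/\ (i < (h n).+1)%N, A = (e (p n) i).2 &
                                   ~ A `<=` (p n).2]].
exists V; split.
- by move=> A [n [i [_ -> nA]]]; have [_ [//|[]]] := e_move (lp n) i.
- move=> x; have [N pNx] := hP x; exists (p N).1.
    by apply: open_nbhs_nbhs; split=> //; exact: (lp N).1.
  apply: (@sub_finite_set _ _ (\bigcup_(n in `I_N)
      [set (e (p n) i).2 | i in `I_(h n).+1])).
    move=> A [[n [i [ih -> nA]]] [y [Ay py]]].
    have [nN|Nn] := ltnP n N; first by exists n => //; exists i.
    have [_ [//|[_ /disjoints_subset An]]] := e_move (lp n) i.
    by case: (An y Ay); exact: le1 py.
  by apply: bigcup_finite => // n _; exact: finite_image.
- rewrite /covers -subTset => x _.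
  have [N pNx] : exists n, (p n).2 x.
    by have [n pnx] := hP x; exists n; apply: (lp n).2.2; exact: subset_closure.
  (* The descent reaches the first stage at which [x] enters the second union; the member bringing
     it in is kept. *)
  elim: N pNx => [//|N IHN].
  have [pNx _|pNx] := pselect ((p N).2 x); first exact: IHN.
  rewrite pS => -[//|[i ih ex]]; exists (e (p N) i).2 => //.
  by exists N, i; split=> // /(_ x ex).
Qed.

End play.
End menger_totally_paracompact.

Lemma menger_totally_paracompact (T : topologicalType) :
  regular_space T -> menger T -> totally_paracompact T.
Proof.
move=> regT mT B basisB.
have /choice[e eP] (p : set T * set T) : exists e : nat -> set T * set T,
    legal p -> (forall k, valid_move B p (e k)) /\ forall x, exists k, (e k).1 x.
  have [lp|] := pselect (legal p); last by exists (fun=> p).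
  have [e ?] := exists_moves basisB regT (menger_lindelof mT) lp.
  by exists e.
have e_move p : legal p -> forall k, valid_move B p (e p k) by move=> /eP[].
have e_cov p : legal p -> forall x, exists k, (e p k).1 x by move=> /eP[].
have lr := legal_reached e_move.
have [||||h hP] := @menger_game T (fun s => (reached e s).1) _ _ _ _ mT.
- by move=> s; exact: (lr s).1.
- by move=> s k x; rewrite reached_rcons; left.
- move=> s k k' kk'; rewrite !reached_rcons; apply: setUSS => //.
  by apply: bigcup_sub => i /= ik x ex; exists i => //=; exact: leq_trans kk'.
- move=> s x; have [k ek] := e_cov _ (lr s) x.
  by exists k; rewrite reached_rcons; right; exists k => /=.
exact: play_totally_paracompact hP.
Qed.

(** * From point-finite covers to Menger selections *)

Section totally_metacompact_menger.
Context {T : topologicalType}.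
Variable d : nat -> T.
Hypothesis dP : forall x : T, ~ open [set x] ->
  forall O, open O -> O x -> exists n, O (d n).

Definition finitely_covered (U : set (set T)) (A : set T) :=
  exists W, [/\ W `<=` U, finite_set W & A `<=` \bigcup_(C in W) C].

Definition anchored (U : nat -> set (set T)) : set (set T) :=
  [set A | open A /\ exists n, A (d n) /\ finitely_covered (U n) A].

Definition open_singletons : set (set T) :=
  [set A | open A /\ exists x, A = [set x]].

Lemma basis_anchored (U : nat -> set (set T)) : (forall n, open_cover (U n)) ->
  basis (anchored U `|` open_singletons).
Proof.
move=> ocU; split=> [A [[]|[]]//|x O]; rewrite nbhsE => -[P [oP Px] PO].
have [ox|/dP/(_ P oP Px)[n Pn]] := pselect (open [set x]).
  exists [set x]; first by split=> //; right; split=> //; exists x.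
  by move=> _ ->; exact: PO.
have UE y : exists2 C, U n C & C y.
  by have : [set: T] y by []; rewrite -(ocU n).2 => -[C]; exists C.
have [C UC Cx] := UE x; have [D UD Dn] := UE (d n).
exists (P `&` (C `|` D)); last by move=> y [/PO].
split; last by split=> //; left.
left; split.
  by apply: openI => //; apply: openU; exact: (ocU n).1.
exists n; split; first by split=> //; right.
exists [set C; D]; split=> [E [->|->]//||y [_ [Cy|Dy]]].
- exact: finite_set2.
- by exists C => //; left.
- by exists D => //; right.
Qed.

(* In a point-finite family every [d n] lies in finitely many members, so only
   finitely many of its anchored members are counted at stage [n]; what they
   miss is a closed discrete set. *)
Lemma totally_metacompact_menger :
  lindelof T -> totally_metacompact T -> menger T.
Proof.
move=> linT tmT U ocU; have [V [VB pfV covV]] := tmT _ (basis_anchored ocU).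
(* A member of [V] through [d n] may fail to be finitely covered by [U n]; the default [set0] keeps
   the first two clauses unconditional. *)
have /choice[w wP] (nA : nat * set T) : exists W, [/\ W `<=` U nA.1,
    finite_set W & finitely_covered (U nA.1) nA.2 ->
    nA.2 `<=` \bigcup_(C in W) C].
  have [[W [WU finW AW]]|nW] := pselect (finitely_covered (U nA.1) nA.2).
    by exists W.
  by exists set0; split.
pose F n := \bigcup_(A in [set A | V A /\ A (d n)]) w (n, A).
have FU n : F n `<=` U n by move=> C [A _]; have [+ _ _] := wP (n, A); apply.
have finF n : finite_set (F n).
  by apply: bigcup_finite => // A _; have [_ + _] := wP (n, A).
pose O := \bigcup_(C in \bigcup_n F n) C.
have oO : open O by apply: bigcup_open => C [n _ /FU]; exact: (ocU n).1.
have isoO x : ~ O x -> open [set x].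
  move=> nOx; have : [set: T] x by [].
  rewrite -covV => -[A VA Ax].
  have [[oA [n [An fcA]]]|[oA [y Ay]]] := VB A VA.
    have [_ _ /(_ fcA x Ax)[C wC Cx]] := wP (n, A).
    by case: nOx; exists C => //; exists n => //; exists A.
  by move: Ax oA; rewrite Ay => ->.
(* Each point outside [O] lies only in its own singleton, so a countable subcover enumerates all
   such points; [H n] then handles the [n]-th one. *)
have [|V' [subV' cV' covV']] := linT ([set O] `|` [set [set x] | x in ~` O]).
  split; first by move=> A [->//|[x nOx <-]]; exact: isoO.
  rewrite /covers -subTset => x _; have [Ox|nOx] := pselect (O x).
    by exists O => //; left.
  by exists [set x] => //; right; exists x.
have [g gV'] : exists g : nat -> set T, set_surj setT V' g by exact/pcard_surjP.
have /choice[H HP] n : exists W, [/\ W `<=` U n, finite_set W &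
    forall x, g n = [set x] -> exists2 C, W C & C x].
  have [[x gx]|ngx] := pselect (exists x, g n = [set x]); last first.
    by exists set0; split=> // x gx; case: ngx; exists x.
  have : [set: T] x by [].
  rewrite -(ocU n).2 => -[C UC Cx]; exists [set C]; split=> [_ ->//||y gy].
    exact: finite_set1.
  exists C => //; suff -> : y = x by [].
  by have : [set y] y by []; rewrite -gy gx.
exists (fun n => F n `|` H n); split=> [n|].
  have [HU finH _] := HP n; split; first by move=> C [/FU|/HU].
  by rewrite finite_setU.
rewrite /covers -subTset => x _; have [[C [n _ FC] Cx]|nOx] := pselect (O x).
  by exists C => //; exists n => //; left.
have : [set: T] x by [].
rewrite -covV' => -[A V'A Ax]; have [AO|[y _ yA]] := subV' A V'A.
  by case: nOx; rewrite -AO.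
have [n _ gn] := gV' A V'A; have [_ _ /(_ x)[|C HC Cx]] := HP n.
  by rewrite gn -yA; move: Ax; rewrite -yA => ->.
by exists C => //; exists n => //; right.
Qed.

End totally_metacompact_menger.

(** * Regularity and countable selection in real GO-spaces *)

Local Open Scope ring_scope.

(** This is regularity on the right of [x]; the same for [- v] gives the left. If [x] is last in
    [I], then [I] lies in the closed ray up to [x]. Otherwise one cuts at a point between [x] and
    some [y] in [I], or, if there is a jump, the open ray below [y] is the closed ray up to [x]. *)
Lemma rays_half_regular (R : realType) (T : topologicalType) (v : T -> R) :
  injective v ->
  (forall y, open [set z | v z < v y]) -> (forall y, open [set z | v y < v z]) ->
  forall (I : set T) x, open I -> I x ->
  (forall a b c, I a -> I b -> v a <= v c <= v b -> I c) ->
  exists P C, [/\ open P, closed C, P x, P `<=` C &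
    forall y, C y -> v x <= v y -> I y].
Proof.
move=> injv o_lt o_gt I x oI Ix cI.
have clo y : closed (~` [set z | v y < v z]) by exact: open_closedC.
have eq_x y : (~` [set z | v x < v z]) y -> v x <= v y -> I y.
  move=> /negP; rewrite -leNgt => yx xy; suff -> : y = x by [].
  by apply: injv; apply: le_anti; rewrite yx.
have [[y Iy xy]|nIy] := pselect (exists2 y, I y & v x < v y); last first.
  exists I, (~` [set z | v x < v z]); split=> // z Iz /= xz.
  by apply: nIy; exists z.
have [[z xz zy]|nz] := pselect (exists2 z, v x < v z & v z < v y).
  exists [set t | v t < v z], (~` [set t | v z < v t]); split=> //.
    by move=> t /= tz; apply/negP; rewrite -leNgt ltW.
  move=> t /negP; rewrite -leNgt => tz xt; apply: (cI x y) => //.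
  by rewrite xt (le_trans tz) ?ltW.
exists [set z | v z < v y], (~` [set z | v x < v z]); split=> // z /= zy xz.
by apply: nz; exists z.
Qed.

Section real_GO_space_theory.
Context {R : realType} {X : set R} {G : set (set X)}.
Hypothesis goG : real_GO_space G.

Definition GO_val (x : GO_type G) : R := val (x : X).

Lemma GO_val_inj : injective GO_val.
Proof. exact: val_inj. Qed.

(** Basic open sets are finite intersections of members of [G], and convexity passes to
    intersections. *)
Lemma GO_convex_nbhs (x : GO_type G) (O : set (GO_type G)) : nbhs x O ->
  exists I : set (GO_type G), [/\ open I, I x, I `<=` O &
    forall a b c, I a -> I b -> GO_val a <= GO_val c <= GO_val b -> I c].
Proof.
rewrite nbhsE => -[P [[D DG PE] Px] PO].
move: Px; rewrite -PE => -[I DI Ix].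
exists I; split=> //.
- by exists [set I]; [move=> _ ->; exact: DG|rewrite bigcup_set1].
- by move=> y Iy; apply: PO; rewrite -PE; exists I.
have [E EG IE] := DG _ DI; move: Ix DI; rewrite -IE => _ _ a b c Ia Ib acb J EJ.
have GJ : G J by have := EG J EJ; rewrite inE.
by apply: (goG.1 J GJ a b c); [exact: Ia|exact: Ib|].
Qed.

(** By the Hausdorff property [z] has a convex neighbourhood avoiding [y], which therefore cannot
    reach beyond [y]. *)
Lemma GO_open_lt y : open [set z | GO_val z < GO_val y].
Proof.
rewrite openE => z /= zy.
have := goG.2; rewrite open_hausdorff => /(_ z y).
have zNy : z != y by apply: contraTneq zy => ->; rewrite ltxx.
move=> /(_ zNy)[[A B] /= [/set_mem Az /set_mem By] [oA _ /eqP AB]].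
have [|I [oI Iz IA cI]] := @GO_convex_nbhs z A; first exact: open_nbhs_nbhs.
rewrite /interior nbhsE; exists I => // t It /=; rewrite ltNge; apply/negP => yt.
have : (A `&` B) y by split=> //; apply/IA/(cI z t) => //; rewrite (ltW zy).
by rewrite AB.
Qed.

Lemma GO_open_gt y : open [set z | GO_val y < GO_val z].
Proof.
rewrite openE => z /= yz.
have := goG.2; rewrite open_hausdorff => /(_ z y).
have zNy : z != y by apply: contraTneq yz => ->; rewrite ltxx.
move=> /(_ zNy)[[A B] /= [/set_mem Az /set_mem By] [oA _ /eqP AB]].
have [|I [oI Iz IA cI]] := @GO_convex_nbhs z A; first exact: open_nbhs_nbhs.
rewrite /interior nbhsE; exists I => // t It /=; rewrite ltNge; apply/negP => ty.
have : (A `&` B) y by split=> //; apply/IA/(cI t z) => //; rewrite ty ltW.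
by rewrite AB.
Qed.

Lemma GO_regular : regular_space (GO_type G).
Proof.
move=> x A /GO_convex_nbhs[I [oI Ix IA cI]].
have [P [C [oP cC Px PC CI]]] :=
  rays_half_regular GO_val_inj GO_open_lt GO_open_gt oI Ix cI.
have [||||Q [D [oQ cD Qx QD DI]]] :=
  @rays_half_regular R (GO_type G) (fun z => - GO_val z) _ _ _ I x oI Ix.
- by move=> y z /oppr_inj/GO_val_inj.
- move=> y; have -> : [set z | - GO_val z < - GO_val y] =
      [set z | GO_val y < GO_val z] by apply/seteqP; split=> z /=; rewrite ltrN2.
  exact: GO_open_gt.
- move=> y; have -> : [set z | - GO_val y < - GO_val z] =
      [set z | GO_val z < GO_val y] by apply/seteqP; split=> z /=; rewrite ltrN2.
  exact: GO_open_lt.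
- by move=> a b c Ia Ib; rewrite !lerN2 andbC => /(cI b a c Ib Ia).
exists (P `&` Q).
  by apply: open_nbhs_nbhs; split; [exact: openI|].
move=> y /closureI[]; move/closure_id: cC (closureS PC) => <- PC'.
move/closure_id: cD (closureS QD) => <- QD' /PC' Cy /QD' Dy; apply: IA.
have [xy|yx] := leP (GO_val x) (GO_val y); first exact: CI.
by apply: DI => //; rewrite lerN2 ltW.
Qed.

(** A point is selected between each pair of rationals that has one. Rationals on either side of [b]
    form such a pair, with [b] as witness. *)
Lemma GO_between_rat_seq (x0 : GO_type G) : exists d : nat -> GO_type G,
  forall a b c, GO_val a < GO_val b -> GO_val b < GO_val c ->
  exists n, GO_val a < GO_val (d n) < GO_val c.
Proof.
have /choice[f fP] (q : rat * rat) : exists t : GO_type G,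
    (exists t', ratr q.1 < GO_val t' < ratr q.2) ->
    ratr q.1 < GO_val t < ratr q.2.
  have [[t' qt']|nq] := pselect (exists t', ratr q.1 < GO_val t' < ratr q.2).
    by exists t'.
  by exists x0.
exists (fun n => oapp f x0 (unpickle n)) => a b c.
move=> /rat_in_itvoo[q1]; rewrite in_itv/= => /andP[aq1 q1b].
move=> /rat_in_itvoo[q2]; rewrite in_itv/= => /andP[bq2 q2c].
exists (pickle (q1, q2)); rewrite pickleK /=.
have /andP[] : ratr q1 < GO_val (f (q1, q2)) < ratr q2.
  by apply: (fP (q1, q2)); exists b; rewrite /= q1b.
by move=> /(lt_trans aq1) -> /lt_trans /(_ q2c) ->.
Qed.

(* A non-isolated point of a T1 space has three points in each neighbourhood;
   in a convex one, the rational selection falls between the extreme two. *)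
Lemma GO_dense_seq (x0 : GO_type G) : exists d : nat -> GO_type G,
  forall x, ~ open [set x] -> forall O, open O -> O x -> exists n, O (d n).
Proof.
have [d dP] := GO_between_rat_seq x0; exists d => x nox O oO Ox.
have [|I [oI Ix IO cI]] := @GO_convex_nbhs x O; first exact: open_nbhs_nbhs.
have other (J : set (GO_type G)) : open J -> J x -> exists2 y, J y & y <> x.
  move=> oJ Jx; apply: contrapT => nJ; apply: nox.
  suff -> : [set x] = J by [].
  apply/seteqP; split=> [_ ->//|y Jy]; apply: contrapT => yx.
  by apply: nJ; exists y.
have [y Iy yx] := other I oI Ix.
have [||z [Iz zy] zx] := other (I `&` ~` [set y]).
- apply: openI => //; apply: closed_openC.
  exact/accessible_closed_set1/hausdorff_accessible/goG.2.
- by split=> // /esym.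
have between a b c : I a -> I c -> GO_val a < GO_val b -> GO_val b < GO_val c ->
    exists n, O (d n).
  move=> Ia Ic ab bc; have [n /andP[an nc]] := dP a b c ab bc.
  by exists n; apply/IO/(cI a c) => //; rewrite !ltW.
(* The three points are distinct; each of their six orders is one instance of [between]. *)
have := between x y z; have := between x z y; have := between y x z.
have := between y z x; have := between z x y; have := between z y x.
case: (ltgtP (GO_val x) (GO_val y)) => [xy|xy|/GO_val_inj/esym//];
case: (ltgtP (GO_val y) (GO_val z)) => [yz|yz|/GO_val_inj/esym//];
case: (ltgtP (GO_val x) (GO_val z)) => [xz|xz|/GO_val_inj/esym//]; by eauto.
Qed.

End real_GO_space_theory.

Lemma totally_paracompact_metacompact (T : topologicalType) :
  totally_paracompact T -> totally_metacompact T.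
Proof.
move=> tpT B /tpT[V [VB lfV covV]]; exists V; split=> // x.
have [O nO finO] := lfV x; apply: sub_finite_set finO => A [VA Ax].
by split=> //; exists x; split=> //; exact: nbhs_singleton.
Qed.

Theorem corollary3p2 (R : realType) (X : set R) (G : set (set X)) :
  real_GO_space G -> infinite_set X -> lindelof (GO_type G) ->
  (menger (GO_type G) <-> totally_paracompact (GO_type G)) /\
  (totally_paracompact (GO_type G) <-> totally_metacompact (GO_type G)).
Proof.
move=> goG /infinite_setN0[r Xr] linG.
have [d dP] := GO_dense_seq goG (SigSub (mem_set Xr)).
have mp := menger_totally_paracompact (GO_regular goG).
have pm := @totally_paracompact_metacompact (GO_type G).
have mm := totally_metacompact_menger dP linG.
by split; split; [exact: mp|move/pm/mm|exact: pm|move/mm/mp].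
Qed.
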